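(* Let $d\ge1$, $n\ge d+1$, $T=\{t_1<\dots<t_n\}\subset\mathbb R$, and $\sigma$ a chamber of the arrangement $\{\xi\in\mathbb R^{d+1}:q_\xi(t)=0\}$, $t\in T$. A subset $S\subset T$ with $|S|=d$ corresponds to a facet of $P_\sigma(T)$ if and only if the sequence $L=[n]\setminus\{j: t_j\in S\}=\{l_1<\dots<l_{n-d}\}$ is $\sigma$-parity alternating.
   Context: $\nu_d(t)=(1,t,\dots,t^d)$ and $q_\xi(t)=\sum_{i=0}^d\xi_it^i$. For $\xi$ with $q_\xi(t)\ne0$ on $T$, $P_\xi(T)=\mathrm{conv}\{\nu_d(t)/q_\xi(t):t\in T\}$ is a $d$-polytope; for a chamber $\sigma$ (closure of a connected component of the complement of the hyperplanes $\{\xi:q_\xi(t)=0\}$, $t\in T$), $P_\sigma(T)$ denotes $P_\xi(T)$ for any $\xi$ in the interior of $\sigma$ (its combinatorial type does not depend on this choice), and $\mathrm{sgn}_\sigma(t)=\mathrm{sgn}\,q_\xi(t)$ for such $\xi$. $S$ corresponds to a facet if the points $\nu_d(t)/q_\xi(t)$, $t\in S$, are the vertices of a facet. A subsequence $l_1<\dots<l_m$ of $[n]=\{1,\dots,n\}$ is $\sigma$-parity alternating if for every $i\in[m-1]$: $\mathrm{sgn}_\sigma(t_{l_i})=\mathrm{sgn}_\sigma(t_{l_{i+1}})$ if and only if $l_i$ and $l_{i+1}$ have different parities. *)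

(* Defs.v *)
From HB Require Import structures.
From mathcomp Require Export all_boot all_order all_algebra.
From mathcomp Require Export all_classical all_reals all_analysis.

Set Implicit Arguments.
Unset Strict Implicit.
Unset Printing Implicit Defensive.

Import Order.TTheory GRing.Theory Num.Theory.
Import numFieldNormedType.Exports.

Local Open Scope classical_set_scope.
Local Open Scope ring_scope.

Section Polytopes.
Variables (R : realType) (N : nat).
Implicit Types (A F P : set 'rV[R]_N) (v : 'rV[R]_N).

Definition conv_hull A : set 'rV[R]_N := smallest (@convex_set R 'rV[R]_N) A.

Definition affine_hull A : set 'rV[R]_N :=
  [set x | exists (k : nat) (p : 'I_k -> 'rV[R]_N) (w : 'I_k -> R),
     [/\ forall i, A (p i), \sum_i w i = 1 & x = \sum_i w i *: p i]].

(* Only nonempty sets have a dimension in this sense. *)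
Definition affine_dim A (m : nat) : Prop :=
  exists (x : 'rV[R]_N) (U : {vspace 'rV[R]_N}),
    affine_hull A = [set x + u | u in [set` U]] /\ \dim U = m.

(* The improper faces [P] and [set0] are included; [c] may be zero. *)
Definition face P F : Prop :=
  exists (c : 'cV[R]_N) (b : R),
    (forall x, P x -> (x *m c) 0 0 <= b) /\
    F = P `&` [set x | (x *m c) 0 0 = b].

Definition vertices P : set 'rV[R]_N := [set v | face P [set v]].

Definition facet P F : Prop :=
  face P F /\ exists m : nat, affine_dim P m.+1 /\ affine_dim F m.

End Polytopes.

Section Chambers.
Variables (R : realType) (d n : nat).
Implicit Types (xi : 'rV[R]_d.+1) (t : 'I_n -> R) (x : R).

Definition nu x : 'rV[R]_d.+1 := \row_(i < d.+1) x ^+ i.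

Definition q xi x : R := \sum_(i < d.+1) xi 0 i * x ^+ i.

Definition point xi x : 'rV[R]_d.+1 := (q xi x)^-1 *: nu x.

Definition polytope xi t : set 'rV[R]_d.+1 :=
  conv_hull (range (fun i => point xi (t i))).

Definition hyperplane x : set 'rV[R]_d.+1 := [set xi | q xi x = 0].

Definition arrangement_compl t : set 'rV[R]_d.+1 :=
  ~` \bigcup_i hyperplane (t i).

Definition chamber t (sigma : set 'rV[R]_d.+1) : Prop :=
  exists2 xi, arrangement_compl t xi &
    sigma = closure (connected_component (arrangement_compl t) xi).

(* A subset of {t_1 < ... < t_n} is represented by its set of indices. *)
Definition corresponds_to_facet xi t (S : {set 'I_n}) : Prop :=
  exists F, facet (polytope xi t) F /\
    vertices F = [set point xi (t i) | i in [set` S]].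

(* Indices start at 0 rather than 1; this does not affect whether two indices
   have different parities. *)
Definition parity_alternating (sgn : 'I_n -> R) (l : seq 'I_n) : bool :=
  sorted (fun i j => (sgn i == sgn j) == (odd i != odd j)) l.

End Chambers.

(* Main.v *)
(** After subtracting a multiple of the equation [dot xi x = 1] of the
    hyperplane containing the points, a supporting functional of the polytope
    is a polynomial [g] of degree at most [d] with [g / q_xi <= 0] on the nodes.
    If the supported face has the [d] points of [S] as vertices, then [g] is a
    multiple of the node polynomial [\prod_(s in S) ('X - t s)]; so [S] is a
    facet if and only if the product of the node polynomial and [q_xi] has
    constant sign off [S].  Between two consecutive nodes [t i < t j] outside
    [S] the node polynomial has [j - i - 1] simple roots, hence this sign is
    constant exactly when [q_xi] alternates as prescribed. *)
From HB Require Import structures.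
Require Import Defs.

Set Implicit Arguments.
Unset Strict Implicit.
Unset Printing Implicit Defensive.

Import Order.TTheory GRing.Theory Num.Theory.
Import numFieldNormedType.Exports.

Local Open Scope classical_set_scope.
Local Open Scope ring_scope.

(** * Linear functionals, affine dimension and convex combinations *)

Section AffineDimension.
Variables (R : realType) (N : nat).
Implicit Types (A : set 'rV[R]_N) (c x : 'rV[R]_N) (V : {vspace 'rV[R]_N}).

Definition dot c x : R := (x *m c^T) 0 0.

Lemma dot_linear c : linear (dot c : 'rV[R]_N -> R^o).
Proof. by move=> a x y; rewrite /dot mulmxDl -scalemxAl !mxE. Qed.

HB.instance Definition _ c :=
  GRing.isLinear.Build R 'rV[R]_N R^o _ (dot c : 'rV[R]_N -> R^o)
    (dot_linear c).

Lemma dot_comb (I : finType) c (w : I -> R) (p : I -> 'rV[R]_N) :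
  dot c (\sum_i w i *: p i) = \sum_i w i * dot c (p i).
Proof. by rewrite linear_sum; apply: eq_bigr => i _; rewrite linearZ. Qed.

Definition dot_ker c : {vspace 'rV[R]_N} :=
  lker (linfun (dot c : 'rV[R]_N -> R^o)).

Lemma mem_dot_ker c x : (x \in dot_ker c) = (dot c x == 0).
Proof. by rewrite memv_ker lfunE. Qed.

(** Rank-nullity for [dot c] on [V]: the image is a nonzero subspace of a line. *)
Lemma dim_cap_dot_ker c V x :
  x \in V -> dot c x != 0 -> \dim V = (\dim (V :&: dot_ker c)).+1.
Proof.
move=> Vx cx; rewrite -(limg_ker_dim (linfun (dot c : 'rV[R]_N -> R^o)) V).
rewrite -[RHS]addn1; congr (_ + _)%N; apply/eqP; rewrite eqn_leq.
have -> /= : (\dim (linfun (dot c : 'rV[R]_N -> R^o) @: V) <= 1)%N.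
  by rewrite (leq_trans (dimvS (subvf _)))// dimvf.
rewrite lt0n dimv_eq0; apply/eqP => V0.
have := memv_img (linfun (dot c : 'rV[R]_N -> R^o)) Vx.
by rewrite V0 memv0 lfunE /= (negPf cx).
Qed.

(** Equal cosets have the same direction space, since directions are differences of points. *)
Lemma affine_dim_unique A m m' : affine_dim A m -> affine_dim A m' -> m = m'.
Proof.
have sub x x' (U U' : {vspace 'rV[R]_N}) :
    [set x + u | u in [set` U]] = [set x' + u | u in [set` U']] ->
    (U <= U')%VS.
  move=> e; apply/subvP => u Uu.
  have [u' U'u' xu] : [set x' + u | u in [set` U']] (x + u).
    by rewrite -e; exists u.
  have [v U'v xv] : [set x' + u | u in [set` U']] x.
    by rewrite -e; exists 0; rewrite ?addr0//; exact: mem0v.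
  suff -> : u = u' - v by rewrite memvB.
  by apply: (addrI x); rewrite -xu -xv addrACA subrr addr0.
move=> [x [U [AU <-]]] [x' [U' [AU' <-]]].
by apply/eqP; rewrite eqn_leq !dimvS//; [apply: (sub x' x)|apply: (sub x x')];
  rewrite -AU -AU'.
Qed.

(** As [dot c] is 1 on the basis [X], the coordinates of any point of [V] with [dot c = 1] sum to 1.
    So the affine hull of [A] is this whole slice of [V]. This serves both for the polytope, with
    [V] the full space, and for a facet, with [V] a kernel. *)
Lemma affine_dim_section c A V m (X : m.+1.-tuple 'rV[R]_N) :
  (forall x, A x -> x \in V /\ dot c x = 1) ->
  (forall i : 'I_m.+1, A X`_i) -> basis_of V X ->
  affine_dim A m.
Proof.
move=> AV AX bX.
have [VX0 cX0] := AV _ (AX ord0).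
exists X`_0, (V :&: dot_ker c)%VS; split; last first.
  apply: succn_inj; rewrite -(dim_cap_dot_ker VX0) ?cX0 ?oner_neq0//.
  by rewrite -(size_basis bX).
apply/seteqP; split=> [_ [k [p [w [Ap w1 ->]]]]|_ [u /= /memv_capP[Vu cu] <-]].
  exists (\sum_i w i *: p i - X`_0); last by rewrite addrC subrK.
  apply/memv_capP; split.
    rewrite memvB// memv_suml// => i _.
    by rewrite memvZ//; have [] := AV _ (Ap i).
  rewrite mem_dot_ker linearB /= dot_comb cX0 subr_eq0 -w1.
  apply/eqP/eq_bigr => i _.
  by have [_ ->] := AV _ (Ap i); rewrite mulr1.
have VXu : X`_0 + u \in V by rewrite memvD.
exists m.+1, (fun i => X`_i), (fun i => coord X i (X`_0 + u)); split=> //.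
  transitivity (dot c (X`_0 + u)).
    rewrite [in RHS](coord_basis bX VXu) dot_comb; apply: eq_bigr => i _.
    by have [_ ->] := AV _ (AX i); rewrite mulr1.
  rewrite linearD /= cX0; move: cu; rewrite mem_dot_ker => /eqP ->.
  by rewrite addr0.
exact: (coord_basis bX VXu).
Qed.

(** The convex combinations form a convex set containing the points, and the hull is the smallest
    such set. *)
Lemma conv_hull_comb n (p : 'I_n -> 'rV[R]_N) x : conv_hull (range p) x ->
  exists w : 'I_n -> R,
    [/\ forall i, 0 <= w i, \sum_i w i = 1 & x = \sum_i w i *: p i].
Proof.
pose C := [set x | exists w : 'I_n -> R,
  [/\ forall i, 0 <= w i, \sum_i w i = 1 & x = \sum_i w i *: p i]].
move: x; apply: (@smallest_sub _ _ _ C) => [y z l|_ [i _ <-]].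
  rewrite !inE => -[w [w0 w1 ->]] [w' [w'0 w'1 ->]].
  exists (fun i => l%:num * w i + (1 - l%:num) * w' i); split.
  - by move=> i; rewrite addr_ge0 ?mulr_ge0// subr_ge0.
  - by rewrite big_split /= -!mulr_sumr w1 w'1 !mulr1 addrC subrK.
  - rewrite -[LHS]/(l%:num *: _ + (1 - l%:num) *: _).
    under [RHS]eq_bigr do rewrite scalerDl -!scalerA.
    by rewrite big_split /= -!scaler_sumr.
exists (fun j => (j == i)%:R); split=> [j||]; first exact: ler0n.
  by rewrite (bigD1 i)//= eqxx big1 ?addr0// => j /negPf ->.
rewrite (bigD1 i)//= eqxx scale1r big1 ?addr0// => j /negPf ->.
by rewrite scale0r.
Qed.

End AffineDimension.

(** * Signs of node polynomials and parity alternation *)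

Section ParityAlternation.
Variables (R : realType) (n : nat) (t : 'I_n -> R).
Hypothesis t_incr : forall i j : 'I_n, (i < j)%N -> t i < t j.

Definition node_poly (B : {set 'I_n}) : {poly R} :=
  \prod_(b in B) ('X - (t b)%:P).

Lemma horner_node_poly B x : (node_poly B).[x] = \prod_(b in B) (x - t b).
Proof. by rewrite horner_prod; under eq_bigr do rewrite hornerXsubC. Qed.

Lemma size_node_poly B : size (node_poly B) = #|B|.+1.
Proof. by rewrite /node_poly -big_enum size_prod_XsubC cardE. Qed.

Lemma nodes_inj : injective t.
Proof.
move=> i j tij; apply/val_inj/eqP; rewrite eqn_leq.
by case: ltngtP => // /t_incr; rewrite tij ltxx.
Qed.

Lemma node_poly_eq0 B i : ((node_poly B).[t i] == 0) = (i \in B).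
Proof.
rewrite horner_node_poly; apply/prodf_eq0/idP => [[b Bb]|Bi].
  by rewrite subr_eq0 => /eqP/nodes_inj ->.
by exists i; rewrite ?subrr.
Qed.

(** If [p] is nonzero, its distinct roots at the nodes of [B] already exhaust its degree, so [a] is
    its leading coefficient. *)
Lemma root_nodes_scale_node_poly (p : {poly R}) (B : {set 'I_n}) :
  (size p <= #|B|.+1)%N ->
  (forall b, b \in B -> p.[t b] = 0) -> exists a, p = a *: node_poly B.
Proof.
move=> sp pB; have [->|p0] := eqVneq p 0; first by exists 0; rewrite scale0r.
pose rs := [seq t b | b <- enum B].
have urs : uniq rs by rewrite map_inj_uniq ?enum_uniq//; exact: nodes_inj.
have rrs : all (root p) rs.
  apply/allP => _ /mapP[b Bb ->]; apply/rootP/pB.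
  by rewrite mem_enum in Bb.
have srs : size rs = #|B| by rewrite size_map cardE.
exists (lead_coef p).
rewrite {1}(@all_roots_prod_XsubC _ p rs) ?uniq_rootsE//; last first.
  by apply/eqP; rewrite eqn_leq srs sp -srs max_poly_roots.
by rewrite big_map big_enum.
Qed.

(** The exponent is the parity of [j - i - 1], the number of factors, as a boolean sum. *)
Lemma prod_sign_between (i j : 'I_n) : (i < j)%N ->
  \prod_(k < n | (i < k < j)%N) (-1 : R) = (-1) ^+ (odd j (+) ~~ odd i).
Proof.
move=> ij; rewrite -(big_mkord (fun k => i < k < j)%N (fun=> -1 : R)) /=.
rewrite -(@big_nat_widen _ _ _ _ j n (fun k => i < k)%N)//=; last exact/ltnW.
rewrite -(@big_nat_widenl _ _ _ i.+1 0 j xpredT)//= prodr_const_nat.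
by rewrite -[LHS]signr_odd oddB//= addbC.
Qed.

(** The factor of the node [t k] has opposite signs at [t i] and [t j] exactly when [k] lies
    strictly between [i] and [j], and all such [k] are in [B]. *)
Lemma sg_node_poly_gap (B : {set 'I_n}) (i j : 'I_n) :
  i \notin B -> j \notin B -> (i < j)%N ->
  (forall k : 'I_n, (i < k < j)%N -> k \in B) ->
  Num.sg (node_poly B).[t i] * Num.sg (node_poly B).[t j] =
  (-1) ^+ (odd j (+) ~~ odd i).
Proof.
move=> iB jB ij gap; rewrite -sgrM !horner_node_poly -big_split /=.
rewrite -(prod_sign_between ij) (big_morph _ (@sgrM R) (sgr1 R)).
rewrite [RHS](eq_bigl (fun k => (k \in B) && (i < k < j)%N)); last first.
  by move=> k; case: (boolP (i < k < j)%N) => [/gap -> //|_]; rewrite andbF.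
rewrite [RHS]big_mkcondr /=; apply: eq_bigr => k Bk; rewrite sgrM.
case: (ltngtP i k) => [ik|ki|/val_inj ik]; last by rewrite ik Bk in iB.
  rewrite ltr0_sg ?subr_lt0 ?t_incr//.
  case: (ltngtP k j) => [kj|jk|/val_inj kj]; last by rewrite -kj Bk in jB.
    by rewrite gtr0_sg ?subr_gt0 ?t_incr// mulr1.
  by rewrite ltr0_sg ?subr_lt0 ?t_incr// mulrNN mulr1.
have kj := ltn_trans ki ij.
by rewrite !gtr0_sg ?mulr1// subr_gt0 t_incr.
Qed.

Lemma enum_ord_sorted (A : {set 'I_n}) :
  sorted (fun i j : 'I_n => (i < j)%N) (enum A).
Proof.
rewrite /enum_mem; apply: sorted_filter => [? ? ?|]; first exact: ltn_trans.
have := iota_ltn_sorted 0 n; rewrite -val_enum_ord sorted_map.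
by rewrite enumT.
Qed.

(** An element of [A] in the gap would have an index strictly between [m] and [m.+1] in the
    increasing list [enum A]. *)
Lemma enum_ord_gap (A : {set 'I_n}) (x0 k : 'I_n) m :
  (m.+1 < size (enum A))%N ->
  (nth x0 (enum A) m < k < nth x0 (enum A) m.+1)%N -> k \notin A.
Proof.
move=> mA; apply: contraL => Ak.
have tr : transitive (fun i j : 'I_n => (i < j)%N).
  by move=> ? ? ?; exact: ltn_trans.
have lt_nth a b : (a < size (enum A))%N -> (b < size (enum A))%N ->
    (a <= b)%N -> (nth x0 (enum A) a <= nth x0 (enum A) b)%N.
  move=> aA bA; rewrite leq_eqVlt => /predU1P[-> //|ab].
  by rewrite ltnW// (sorted_ltn_nth tr x0 (enum_ord_sorted A)).
have kA : (index k (enum A) < size (enum A))%N by rewrite index_mem mem_enum.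
have <- : nth x0 (enum A) (index k (enum A)) = k by rewrite nth_index ?mem_enum.
rewrite negb_and -!leqNgt; have [km|mk] := leqP (index k (enum A)) m.
  by rewrite lt_nth// (ltnW mA).
by rewrite (lt_nth m.+1)// orbT.
Qed.

(** Equality of the products [h] is transitive, so it holds for all pairs once it holds for
    consecutive entries; there [sg_node_poly_gap] turns it into the alternation condition. *)
Lemma parity_alternatingP (B : {set 'I_n}) (f : 'I_n -> R) :
  (forall i, f i != 0) ->
  parity_alternating (fun i => Num.sg (f i)) (enum (~: B)) <->
  {in ~: B &, forall i j,
    Num.sg (f i) * Num.sg (node_poly B).[t i] =
    Num.sg (f j) * Num.sg (node_poly B).[t j]}.
Proof.
move=> f0; set L := enum (~: B).
pose h i := Num.sg (f i) * Num.sg (node_poly B).[t i].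
pose r i j := h i == h j.
have rtr : transitive r by rewrite /r => ? ? ? /eqP -> /eqP ->.
suff -> : parity_alternating (fun i => Num.sg (f i)) L = sorted r L.
  split=> [Lr i j iB jB|hB].
    rewrite -[_ \in _]mem_enum in iB; rewrite -[_ \in _]mem_enum in jB.
    have [ij|ji] := leqP (index i L) (index j L).
      apply/eqP; rewrite -/(h i) -/(h j) -(nth_index i iB) -(nth_index i jB).
      by apply: (sorted_leq_nth rtr); rewrite ?inE ?index_mem// /r.
    apply/esym/eqP; rewrite -/(h i) -/(h j) -(nth_index i iB) -(nth_index i jB).
    by apply: (sorted_leq_nth rtr); rewrite ?inE ?index_mem ?(ltnW ji)// /r.
  (* Every list is sorted for the relation that always holds, and on the complement of [B] this
     relation implies [r]. *)
  apply: (@sub_in_sorted _ (mem (~: B)) (fun=> xpredT)) => [i j iB jB _||].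
  - exact/eqP/hB.
  - by apply/allP => i; rewrite mem_enum.
  - by elim: L => //= a [|b s] //= IH; apply: IH.
have step (x0 : 'I_n) m : (m.+1 < size L)%N ->
    ((Num.sg (f (nth x0 L m)) == Num.sg (f (nth x0 L m.+1))) ==
     (odd (nth x0 L m) != odd (nth x0 L m.+1))) =
    r (nth x0 L m) (nth x0 L m.+1).
  move=> mL; set i := nth _ _ m; set j := nth _ _ m.+1.
  have iB : i \notin B.
    by have : i \in L := mem_nth x0 (ltnW mL); rewrite mem_enum inE.
  have jB : j \notin B.
    by have : j \in L := mem_nth x0 mL; rewrite mem_enum inE.
  have ij : (i < j)%N.
    by apply: (sortedP x0 (enum_ord_sorted (~: B))) mL.
  have := sg_node_poly_gap iB jB ij.
  rewrite /r /h -!neqr0_sign ?f0 ?node_poly_eq0// -!signr_addb.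
  rewrite !(inj_eq signr_inj) => gap.
  have /gap/signr_inj : forall k : 'I_n, (i < k < j)%N -> k \in B.
    by move=> k /(enum_ord_gap mL); rewrite inE negbK.
  (* With the signs written as powers of -1, what remains is a check over six booleans. *)
  by case: (_ < 0) (_ < 0) (_ < 0) (_ < 0) (odd i) (odd j) => [] [] [] [] [] [].
case E : L => [//|x0 s]; rewrite -E.
by apply/(sortedP x0)/(sortedP x0) => H m mL; have := H m mL; rewrite step.
Qed.

End ParityAlternation.

(** * Constancy of signs on the interior of a chamber *)

Section Chambers.
Variables (R : realType) (d n : nat) (t : 'I_n -> R).
Implicit Types (sigma : set 'rV[R]_d.+1) (xi eta zeta : 'rV[R]_d.+1).

Lemma q_rVpoly xi x : q xi x = (rVpoly xi).[x].
Proof.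
rewrite /q (@horner_coef_wide _ d.+1) ?size_poly//.
by apply: eq_bigr => i _; rewrite coef_rVpoly_ord.
Qed.

Lemma q_dot xi x : q xi x = dot (nu d x) xi.
Proof. by rewrite /dot mxE; apply: eq_bigr => i _; rewrite !mxE. Qed.

Lemma qD a xi zeta x : q (zeta + a *: xi) x = q zeta x + a * q xi x.
Proof. by rewrite !q_dot linearD linearZ. Qed.

Lemma continuous_q x : continuous ((q (d := d))^~ x : 'rV[R]_d.+1 -> R).
Proof.
move=> xi; apply: (@cvg_big _ _ _ _ _ (@add_continuous R)).
  exact: nbhs_filter.
move=> i _; apply: (@cvgMr_tmp _ _ (nbhs xi)); exact: coord_continuous.
Qed.

(** The factor [s] makes [f] positive at the base point [xi0]. Then [f] is nonnegative on the
    component by the intermediate value theorem, on its closure by continuity, and positive on the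
    interior of the closure by a perturbation. *)
Lemma chamber_interior_q sigma xi eta i : chamber t sigma ->
  interior sigma xi -> interior sigma eta ->
  0 < q xi (t i) * q eta (t i).
Proof.
move=> [xi0 xi0A ->].
set C := connected_component _ _; set x := t i; set s := q xi0 x.
have qC0 zeta : C zeta -> q zeta x != 0.
  move=> /connected_component_sub Az; apply/eqP => z0; apply: Az.
  by exists i.
have Cxi0 : C xi0 by exact: connected_component_refl.
have s0 : s != 0 by exact: qC0.
pose f zeta : R := s * q zeta x.
have fcont : continuous f.
  by move=> zeta; apply: (@cvgMl_tmp _ _ (nbhs zeta)); exact: continuous_q.
have fC zeta : C zeta -> 0 <= f zeta.
  move=> Cz; rewrite leNgt; apply/negP => fz.
  have /connected_intervalP fCi : connected (f @` C).
    apply: connected_continuous_connected; first exact: component_connected.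
    exact: continuous_subspaceT.
  have [z Cz' /eqP] : (f @` C) 0.
    apply: (fCi (f zeta) (f xi0)); [by exists zeta|by exists xi0|].
    by rewrite (ltW fz) /f -expr2 sqr_ge0.
  by rewrite mulf_eq0 (negPf s0) (negPf (qC0 _ Cz')).
have clC zeta : closure C zeta -> 0 <= f zeta.
  have cl : closed (f @^-1` [set y | 0 <= y]).
    by apply: preimage_closed; [move=> ? _; exact: fcont|exact: closed_ge].
  by move=> /(closureS fC); rewrite -((closure_id _).1 cl).
have intC zeta : interior (closure C) zeta -> 0 < f zeta.
  move=> Cz; rewrite lt_def clC ?andbT; last exact: interior_subset Cz.
  (* Moving the constant coefficient of a zero of [f] in the direction [- s]
     makes [f] negative, while staying in [closure C] for a small step. *)
  apply/eqP => fz; pose g e := zeta + (- (e * s)) *: delta_mx 0 0.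
  have q1 : q (delta_mx 0 0 : 'rV[R]_d.+1) x = 1.
    rewrite /q (bigD1 ord0)//= mxE !eqxx mul1r big1 ?addr0// => j /negPf j0.
    by rewrite mxE j0 andbF mul0r.
  have fg e : f (g e) = - (e * s ^+ 2).
    by rewrite /f qD q1 mulrDr -/(f zeta) fz add0r mulr1 mulrN mulrCA expr2.
  have gcont : {for 0, continuous g}.
    apply: cvgD; first exact: cvg_cst.
    apply: cvgZr_tmp; apply: cvgN; apply: cvgMr_tmp; exact: cvg_id.
  have /gcont/nbhs_ballP[e /= e0 eC] : nbhs (g 0) (closure C).
    by rewrite /g mul0r oppr0 scale0r addr0; exact: Cz.
  have : 0 <= f (g (e / 2)).
    apply/clC/eC; rewrite -ball_normE /= sub0r normrN gtr0_norm ?divr_gt0//.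
    by rewrite ltr_pdivrMr// ltr_pMr// ltr1n.
  by rewrite fg oppr_ge0 leNgt mulr_gt0 ?divr_gt0// exprn_even_gt0.
(* The product of the two values of [f] is [s ^+ 2] times the product in the goal. *)
move=> /intC fxi /intC feta; have := mulr_gt0 fxi feta.
by rewrite /f mulrACA pmulr_rgt0// -expr2 exprn_even_gt0.
Qed.

End Chambers.

(** * Facets of the polytope and sign conditions on node polynomials *)

Section Facets.
Variables (R : realType) (d n : nat) (t : 'I_n -> R) (xi : 'rV[R]_d.+1).
Hypothesis t_incr : forall i j : 'I_n, (i < j)%N -> t i < t j.
Hypothesis q_neq0 : forall i, q xi (t i) != 0.

Local Notation p := (fun i => point xi (t i)).
Local Notation P := (polytope xi t).

(** This translates functionals on the points into polynomials of degree at most [d], divided by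
    [q xi]. *)
Lemma dot_point c i : dot c (p i) = q c (t i) / q xi (t i).
Proof.
rewrite /point linearZ /= [RHS]mulrC; congr (_ * _).
by rewrite /dot mxE; apply: eq_bigr => j _; rewrite !mxE mulrC.
Qed.

Lemma polytope_point i : P (p i).
Proof. by apply: sub_gen_smallest; exists i. Qed.

Lemma polytope_comb x : P x -> exists w : 'I_n -> R,
  [/\ forall i, 0 <= w i, \sum_i w i = 1 & x = \sum_i w i *: p i].
Proof. exact: conv_hull_comb. Qed.

(** At each generating point the value is [q xi / q xi]. On the polytope, constants can thus be
    traded for multiples of [dot xi]. *)
Lemma dot_polytope x : P x -> dot xi x = 1.
Proof.
move=> /polytope_comb[w [_ w1 ->]]; rewrite dot_comb -w1.
by apply: eq_bigr => i _; rewrite dot_point divff ?mulr1.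
Qed.

Lemma dot_polytope_le c b : (forall i, dot c (p i) <= b) ->
  forall x, P x -> dot c x <= b.
Proof.
move=> cb _ /polytope_comb[w [w0 w1 ->]]; rewrite dot_comb.
by rewrite -[b]mul1r -w1 mulr_suml ler_sum// => i _; rewrite ler_wpM2l.
Qed.

(** [poly_rV] drops coefficients beyond degree [d], whence the bound on [#|B|] in the lemmas on
    [node_row]. *)
Definition node_row (B : {set 'I_n}) : 'rV[R]_d.+1 := poly_rV (node_poly t B).

Lemma q_node_row (B : {set 'I_n}) x : (#|B| <= d)%N ->
  q (node_row B) x = (node_poly t B).[x].
Proof. by move=> Bd; rewrite q_rVpoly poly_rV_K// size_node_poly. Qed.

Lemma dot_node_row_eq0 (B : {set 'I_n}) i : (#|B| <= d)%N ->
  (dot (node_row B) (p i) == 0) = (i \in B).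
Proof.
move=> Bd; rewrite dot_point mulf_eq0 invr_eq0 (negPf (q_neq0 i)) orbF.
by rewrite q_node_row// node_poly_eq0.
Qed.

(** The node polynomial of the other, at most [d], nodes gives a functional that vanishes at every
    point of the family but the [i]-th and so isolates its coefficient. *)
Lemma free_points m (f : 'I_m -> 'I_n) : injective f -> (m <= d.+1)%N ->
  free [tuple p (f k) | k < m].
Proof.
move=> finj md; apply/freeP => k k0 i.
pose B := f @: [set~ i]%SET.
have Bd : (#|B| <= d)%N by rewrite card_imset// cardsC1 card_ord; case: (m) md.
have /eqP : dot (node_row B) (\sum_(j < m) k j *: p (f j)) = 0.
  under eq_bigr => j _.
    rewrite -(tnth_mktuple (fun j => p (f j)) j) (tnth_nth 0).
    over.
  by rewrite k0 linear0.
rewrite dot_comb (bigD1 i)//= big1 ?addr0 => [|j ji].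
  rewrite mulf_eq0 dot_node_row_eq0// mem_imset// !inE eqxx orbF.
  by move=> /eqP.
apply/eqP; rewrite mulf_eq0 dot_node_row_eq0// mem_imset// !inE ji.
by rewrite orbT.
Qed.

Lemma affine_dim_polytope : (d < n)%N -> affine_dim P d.
Proof.
move=> dn; pose X := [tuple p (widen_ord dn k) | k < d.+1].
apply: (@affine_dim_section _ _ xi _ fullv _ X).
- by move=> x Px; rewrite memvf dot_polytope.
- by move=> i; rewrite -tnth_nth tnth_mktuple; exact: polytope_point.
- rewrite basisEfree free_points ?subvf ?dimvf ?dim_matrix//.
    by rewrite size_tuple mul1r leqnn.
  by move=> i j /(congr1 val) /= ij; exact: val_inj.
Qed.

Lemma facet_node_poly_sign (S : {set 'I_n}) : #|S| = d -> (d < n)%N ->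
  corresponds_to_facet xi t S ->
  {in ~: S &, forall i j,
    Num.sg (q xi (t i)) * Num.sg (node_poly t S).[t i] =
    Num.sg (q xi (t j)) * Num.sg (node_poly t S).[t j]}.
Proof.
move=> Sd dn [F [[[c [b [Pb FE]]] [m [dP dF]]] vF]].
(* As [dot xi] is 1 on [P], this makes the supporting inequality homogeneous: [dot g <= 0], with
   equality on [F]. *)
pose g := c^T - b *: xi.
have dot_g x : P x -> dot g x = (x *m c) 0 0 - b.
  move=> Px; rewrite /dot /g linearB linearZ /= trmxK mulmxBr -scalemxAr.
  rewrite mxE [X in _ + X]mxE [X in _ - X]mxE -/(dot xi x).
  by rewrite dot_polytope// mulr1.
have gS s : s \in S -> (rVpoly g).[t s] = 0.
  move=> Ss; have [c' [b' [_ e]]] : vertices F (p s) by rewrite vF; exists s.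
  have : F (p s) by have : [set p s] (p s) := erefl; rewrite e => -[].
  rewrite FE => -[Pp /= pb]; have /eqP := dot_g _ Pp.
  rewrite pb subrr dot_point mulf_eq0 invr_eq0 (negPf (q_neq0 s)) orbF.
  by rewrite q_rVpoly => /eqP.
have [|a ga] := root_nodes_scale_node_poly t_incr _ gS.
  by rewrite Sd size_poly.
(* Otherwise [g] is zero and [F] is all of [P], contradicting the drop in dimension. *)
have a0 : a != 0.
  apply/eqP => a0; have g0 : g = 0 by rewrite -[g]rVpolyK ga a0 scale0r linear0.
  have FP : F = P.
    rewrite FE; apply/setIidl => x Px /=; apply/eqP; rewrite -subr_eq0 -dot_g//.
    by rewrite g0 /dot trmx0 mulmx0 mxE.
  rewrite FP in dF; have /eqP := affine_dim_unique dP dF.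
  by rewrite eqn_leq ltnn.
have sgS i : i \notin S ->
    Num.sg (q xi (t i)) * Num.sg (node_poly t S).[t i] = - Num.sg a.
  move=> iS; have : dot g (p i) <= 0.
    by rewrite dot_g ?subr_le0 ?Pb//; exact: polytope_point.
  rewrite dot_point q_rVpoly ga hornerZ.
  have : (node_poly t S).[t i] != 0 by rewrite node_poly_eq0.
  move: (node_poly t S).[t i] (q xi (t i)) (q_neq0 i) => u v v0 u0 le0.
  (* Off [S] the node polynomial is nonzero, so the supporting inequality is strict and determines
     the sign. *)
  have /ltr0_sg : a * u / v < 0 by rewrite lt_neqAle le0 !mulf_neq0 ?invr_eq0.
  rewrite !sgrM sgrV => sauv; rewrite mulrC -[LHS]mul1r.
  have <- : Num.sg a ^+ 2 = 1 by rewrite sqr_sg a0.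
  by rewrite expr2 -mulrA [X in _ * X]mulrA sauv mulrN1.
by move=> i j; rewrite !inE => iS jS; rewrite !sgS.
Qed.

Lemma node_poly_sign_facet (S : {set 'I_n}) : #|S| = d -> (0 < d < n)%N ->
  {in ~: S &, forall i j,
    Num.sg (q xi (t i)) * Num.sg (node_poly t S).[t i] =
    Num.sg (q xi (t j)) * Num.sg (node_poly t S).[t j]} ->
  corresponds_to_facet xi t S.
Proof.
move=> Sd /andP[d0 dn] sgS.
have [l lS] : exists l, l \in ~: S.
  apply/card_gt0P; rewrite -(ltn_add2l #|S|) cardsC card_ord Sd addn0//.
(* The sign common to all nodes off [S]; the factor [- e] makes [dot c] negative at those points. *)
pose e := Num.sg (q xi (t l)) * Num.sg (node_poly t S).[t l].
have Sd' : (#|S| <= d)%N by rewrite Sd.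
pose c := - e *: node_row S.
have dot_c x : dot c x = - (e * dot (node_row S) x).
  by rewrite /dot /c linearZ /= -scalemxAr mxE mulNr.
have cS i : i \in S -> dot c (p i) = 0.
  move=> iS; apply/eqP; rewrite dot_c oppr_eq0 mulf_eq0.
  by rewrite dot_node_row_eq0// iS orbT.
have cNS i : i \notin S -> dot c (p i) < 0.
  move=> iS; have iS' : i \in ~: S by rewrite inE.
  rewrite dot_c; have -> : e = Num.sg (dot (node_row S) (p i)).
    by rewrite dot_point q_node_row// sgrM sgrV mulrC; exact: sgS.
  by rewrite -normrEsg oppr_lt0 normr_gt0 dot_node_row_eq0.
have c_le0 x : P x -> dot c x <= 0.
  apply: dot_polytope_le => i; have [/cS ->//|/cNS/ltW//] := boolP (i \in S).
pose F := P `&` [set x | dot c x = 0].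
have FS i : i \in S -> F (p i).
  by move=> /cS ci; split=> //; exact: polytope_point.
(* A convex combination of nonpositive values is 0 only if each term is 0, so no weight falls on a
   point off [S]. *)
have F_comb x : F x -> exists w : 'I_n -> R,
    [/\ forall i, 0 <= w i, \sum_i w i = 1, forall i, i \notin S -> w i = 0 &
        x = \sum_i w i *: p i].
  move=> [/polytope_comb[w [w0 w1 ->]] /= /eqP].
  rewrite dot_comb -oppr_eq0 -sumrN.
  rewrite psumr_eq0 => [/allP ws|i _]; last first.
    rewrite -mulrN mulr_ge0// oppr_ge0; apply: c_le0; exact: polytope_point.
  exists w; split=> // i iS; have := ws i (mem_index_enum i).
  by rewrite /= oppr_eq0 mulf_eq0 (lt_eqF (cNS _ iS)) orbF => /eqP.
have [m dm] : exists m, d = m.+1 by exists d.-1; rewrite prednK.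
exists F; split.
  split; first by exists c^T, 0; split.
  exists m; rewrite -dm; split; first exact: affine_dim_polytope.
  pose f (k : 'I_m.+1) : 'I_n := enum_val (cast_ord (esym (etrans Sd dm)) k).
  have fS k : f k \in S by exact: enum_valP.
  have finj : injective f by move=> a b /enum_val_inj/cast_ord_inj.
  pose X := [tuple p (f k) | k < m.+1].
  (* The point of [l] shows that the kernel of [dot c] is proper, hence of dimension [d]; the [d]
     independent points of [S] form a basis of it. *)
  have c0 : dot c (p l) != 0 by rewrite lt_eqF// cNS//; rewrite inE in lS.
  apply: (@affine_dim_section _ _ xi _ (dot_ker c) _ X).
  - by move=> x [Px /= cx]; rewrite mem_dot_ker cx eqxx dot_polytope.
  - by move=> i; rewrite -tnth_nth tnth_mktuple; exact: FS.
  - rewrite basisEfree free_points ?(leq_trans _ (leqnSn d)) -?dm//=.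
    apply/andP; split.
      by apply/span_subvP => _ /mapP[k _ ->]; rewrite mem_dot_ker cS.
    rewrite size_tuple -dm.
    have := dim_cap_dot_ker (memvf (p l)) c0.
    rewrite capfv dimvf dim_matrix mul1r => -[<-].
    by rewrite card_ord.
apply/seteqP; split=> [v [c' [b' [F_le Fv]]]|_ [s /= Ss <-]].
  have [/F_comb[w [w0 w1 wS vE]] vb] : (F `&` [set x | (x *m c') 0 0 = b']) v.
    by rewrite -Fv.
  have [s ws] : exists s, w s != 0.
    apply/not_existsP => w_0; move: w1; rewrite big1 => [/eqP|i _].
      by rewrite eq_sym oner_eq0.
    by apply/eqP/negPn/negP/w_0.
  have Ss : s \in S by apply: contraNT ws => /wS ->.
  exists s => //; suff : [set v] (p s) by [].
  rewrite Fv; split; first exact: FS.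
  have cb k : k \in S -> dot c'^T (p k) <= b'.
    by move=> Sk; rewrite /dot trmxK F_le//; exact: FS.
  (* The nonnegative slacks of the points of [S] average to the slack at [v], which is 0. So [p s],
     having positive weight, attains the bound too and equals [v]. *)
  have /eqP : \sum_k w k * (b' - dot c'^T (p k)) = 0.
    under eq_bigr do rewrite mulrBr.
    by rewrite sumrB -mulr_suml w1 mul1r -dot_comb -vE /dot trmxK vb subrr.
  rewrite psumr_eq0 => [/allP/(_ s (mem_index_enum s))|k _].
    by rewrite /= mulf_eq0 (negPf ws)/= subr_eq0 /dot trmxK => /eqP.
  have [Sk|/wS ->] := boolP (k \in S); last by rewrite mul0r.
  by rewrite mulr_ge0// subr_ge0 cb.
have Ss' : (#|S :\ s| <= d)%N.
  by rewrite (leq_trans (subset_leq_card (subD1set S s))).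
(* On [F], [dot c'] is the weight of [p s] in a convex combination. *)
pose a := dot (node_row (S :\ s)) (p s).
have a0 : a != 0 by rewrite dot_node_row_eq0// !inE eqxx.
pose c' := a^-1 *: node_row (S :\ s).
have dot_c' x : dot c' x = a^-1 * dot (node_row (S :\ s)) x.
  by rewrite /dot /c' linearZ /= -scalemxAr mxE.
have c's : dot c' (p s) = 1 by rewrite dot_c' mulVf.
have c'_comb w : (forall i, i \notin S -> w i = 0) ->
    dot c' (\sum_i w i *: p i) = w s.
  move=> wS; rewrite dot_comb (bigD1 s)//= c's mulr1 big1 ?addr0// => k ks.
  have [Sk|/wS ->] := boolP (k \in S); last by rewrite mul0r.
  have /eqP : dot (node_row (S :\ s)) (p k) == 0.
    by rewrite dot_node_row_eq0// !inE ks.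
  by rewrite dot_c' => ->; rewrite !mulr0.
(* A weight is at most 1, and weight 1 at [p s] forces all others to vanish, so the bound is
   attained only at [p s]. *)
exists c'^T, 1; split=> [x /F_comb[w [w0 w1 wS ->]]|].
  rewrite -/(dot c' _) c'_comb// -w1 (bigD1 s)//= lerDl.
  exact: sumr_ge0.
apply/seteqP; split=> [_ ->|x [/F_comb[w [w0 w1 wS ->]]]].
  by split; [exact: FS|exact: c's].
rewrite /= -/(dot c' _) c'_comb// => ws.
move: w1; rewrite (bigD1 s)//= ws -[X in _ = X]addr0 => /addrI/eqP.
rewrite psumr_eq0// => /allP w_0.
rewrite (bigD1 s)//= ws scale1r big1 ?addr0// => k ks.
by have /implyP/(_ ks)/eqP -> := w_0 k (mem_index_enum k); rewrite scale0r.
Qed.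

End Facets.

(** * The facet criterion for a chamber *)

Theorem theorem3p3 (R : realType) (d n : nat) (hd : (1 <= d)%N)
    (hn : (d.+1 <= n)%N) (t : 'I_n -> R)
    (ht : forall i j : 'I_n, (i < j)%N -> t i < t j)
    (sigma : set 'rV[R]_d.+1) (hsigma : chamber t sigma)
    (S : {set 'I_n}) (hS : #|S| = d)
    (xi eta : 'rV[R]_d.+1) (hxi : interior sigma xi)
    (heta : interior sigma eta) :
  corresponds_to_facet xi t S <->
  parity_alternating (fun i => Num.sg (q eta (t i))) (enum (~: S)).
Proof.
(* The polytope is taken at [xi] and the signs at [eta]; positivity of these products makes both
   nonzero at the nodes, with equal signs. *)
have qq i : 0 < q xi (t i) * q eta (t i).
  exact: (chamber_interior_q i hsigma).
have xi0 i : q xi (t i) != 0.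
  by apply/eqP => qi; have := qq i; rewrite qi mul0r ltxx.
have eta0 i : q eta (t i) != 0.
  by apply/eqP => qi; have := qq i; rewrite qi mulr0 ltxx.
have sgE i : Num.sg (q eta (t i)) = Num.sg (q xi (t i)).
  have := gtr0_sg (qq i); rewrite sgrM => sg1.
  rewrite -[LHS]mul1r; have <- : Num.sg (q xi (t i)) ^+ 2 = 1.
    by rewrite sqr_sg xi0.
  by rewrite expr2 -mulrA sg1 mulr1.
apply: iff_trans (iff_sym (parity_alternatingP ht S eta0)).
split=> [/(facet_node_poly_sign ht xi0 hS hn) sgS i j iS jS|sgS].
  by rewrite !sgE; exact: sgS.
apply: (node_poly_sign_facet ht xi0 hS) => [|i j iS jS]; first exact/andP.
by rewrite -!sgE; exact: sgS.
Qed.
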